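(* Let $k$ be a field, $S=k[x_1,\ldots,x_n]$, and let $I$ be a constructible ideal of $S$. Then its polarization $P(I)$ is a square-free constructible ideal.
   Context: A monomial ideal of a polynomial ring over $k$ generated in a single degree $q$ is a constructible ideal if it can be obtained by the following recursive procedure: (i) if $u$ is a monomial and $I=(u)$, then $I$ is constructible; (ii) if $I_1,I_2$ are constructible ideals generated in degree $q$ and $I_1\cap I_2$ is a constructible ideal generated in degree $q+1$, then $I_1+I_2$ is a constructible ideal. A square-free constructible ideal is a constructible ideal which is a square-free monomial ideal. The polarization of a monomial $u=x_1^{\alpha_1}\cdots x_n^{\alpha_n}$ is the square-free monomial $u'=\prod_{i=1}^n\prod_{j=1}^{\alpha_i}x_{ij}$. If $I$ is a monomial ideal with monomial generators $u_1,\ldots,u_m$, its polarization $P(I)$ is the ideal generated by $u_1',\ldots,u_m'$ in a polynomial ring over $k$ in sufficiently many variables $x_{ij}$; in a common polynomial ring extension this does not depend on the chosen monomial generators. *)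

(* Defs.v *)
From HB Require Import structures.
From mathcomp Require Import all_boot all_order all_algebra.
From mathcomp Require Import classical_sets.
From mathcomp Require Import mpoly.

Set Implicit Arguments.
Unset Strict Implicit.
Unset Printing Implicit Defensive.

Import GRing.Theory.
Local Open Scope ring_scope.
Local Open Scope classical_set_scope.

Definition ideal_gen (R : comNzRingType) (s : seq R) : set R :=
  [set p | exists c : nat -> R, p = \sum_(i < size s) c i * s`_i].

Definition ideal_add (R : comNzRingType) (I J : set R) : set R :=
  [set p + q | p in I & q in J].

Definition monomial_ideal (k : fieldType) (n : nat) (U : seq 'X_{1..n}) :
    set {mpoly k[n]} :=
  ideal_gen [seq 'X_[u] | u <- U].

Arguments monomial_ideal k {n} U.

Definition generated_in_degree (k : fieldType) (n q : nat)
    (I : set {mpoly k[n]}) : Prop :=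
  exists2 U : seq 'X_{1..n}, all (fun u => mdeg u == q) U
    & I = monomial_ideal k U.

Inductive constructible (k : fieldType) (n : nat) : set {mpoly k[n]} -> Prop :=
| constructible_principal (u : 'X_{1..n}) :
    constructible (ideal_gen [:: 'X_[u]])
| constructible_add (q : nat) (I1 I2 : set {mpoly k[n]}) :
    constructible I1 -> generated_in_degree q I1 ->
    constructible I2 -> generated_in_degree q I2 ->
    constructible (I1 `&` I2) -> generated_in_degree q.+1 (I1 `&` I2) ->
    constructible (ideal_add I1 I2).

Definition squarefree_monomial (n : nat) (u : 'X_{1..n}) : Prop :=
  forall i : 'I_n, (u i <= 1)%N.

Definition squarefree_monomial_ideal (k : fieldType) (n : nat)
    (I : set {mpoly k[n]}) : Prop :=
  exists2 U : seq 'X_{1..n}, forall u, u \in U -> squarefree_monomial u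
    & I = monomial_ideal k U.

Definition squarefree_constructible (k : fieldType) (n : nat)
    (I : set {mpoly k[n]}) : Prop :=
  constructible I /\ squarefree_monomial_ideal I.

(* The variables x_ij, with i < n and j < d, of the polarization ring are
   numbered row by row by [mxvec_index i j : 'I_(n * d)]; the second index
   starts from 0, so the condition 1 <= j <= u_i becomes j < u_i. This is the
   polarization of u only if all the exponents of u are at most d; otherwise
   the product is truncated. *)
Definition polarize_monomial (n d : nat) (u : 'X_{1..n}) : 'X_{1..n * d} :=
  (\sum_(i < n) \sum_(j < d | (j < u i)%N) U_(mxvec_index i j))%MM.

(* [J] is the polarization of [I] in the polynomial ring k[x_ij | i < n, j < d],
   computed from some finite family of monomial generators of [I] whose
   exponents are small enough for x_ij with j < d to suffice. *)
Definition is_polarization (k : fieldType) (n d : nat)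
    (I : set {mpoly k[n]}) (J : set {mpoly k[n * d]}) : Prop :=
  exists U : seq 'X_{1..n},
    [/\ I = monomial_ideal k U,
        (forall u : 'X_{1..n}, u \in U -> forall i : 'I_n, (u i <= d)%N)
      & J = monomial_ideal k [seq polarize_monomial d u | u <- U]].

(* Main.v *)
(* A monomial ideal is the span of the monomials divisible by one of its
   generators, so for monomial ideals sums and intersections are unions of
   generating families and families of pairwise lcms.  Polarization preserves
   divisibility and lcms, hence it is well defined on monomial ideals and
   commutes with sums and intersections, and the recursive construction of I
   can be polarized step by step.  The degrees survive because exponents never
   grow beyond d: as I1 and I2 are generated in degree q, their generators are
   among those of I1 + I2; a generator of degree q + 1 of their intersection is
   divisible by u1 in I1 and u2 in I2 of degree q, and u1 <> u2 because the
   intersection has no monomial of degree q, so it is lcm(u1, u2). *)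

Require Import Defs.
From mathcomp Require Import all_boot all_order all_algebra.
From mathcomp Require Import classical_sets.
From mathcomp Require Import mpoly.

Set Implicit Arguments.
Unset Strict Implicit.

Local Open Scope ring_scope.
Local Open Scope classical_set_scope.

Import GRing.Theory.

(** * Divisibility, degree and lcm of monomials *)

Lemma lem_mdeg (n : nat) (u v : 'X_{1..n}) :
  (u <= v)%MM -> (mdeg u <= mdeg v)%N.
Proof. by move/submK => <-; rewrite mdegD leq_addl. Qed.

Lemma lem_mdeg_eq (n : nat) (u v : 'X_{1..n}) :
  (u <= v)%MM -> (mdeg v <= mdeg u)%N -> u = v.
Proof.
move=> uv; rewrite -{1}(submK uv) mdegD -{2}[mdeg u]add0n leq_add2r leqn0.
by rewrite mdeg_eq0 => /eqP vu0; rewrite -(submK uv) vu0 add0m.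
Qed.

Lemma lem_anti (n : nat) (u v : 'X_{1..n}) :
  (u <= v)%MM -> (v <= u)%MM -> u = v.
Proof. by move=> uv /lem_mdeg; apply: lem_mdeg_eq. Qed.

(** The lcm divides [w]; were its degree at most [q], its divisors [u] and [v] would both equal it,
    against [u != v]. *)
Lemma eq_mlcm_mdegS (n q : nat) (u v w : 'X_{1..n}) :
  mdeg u = q -> mdeg v = q -> mdeg w = q.+1 -> u != v ->
  (u <= w)%MM -> (v <= w)%MM -> mlcm u v = w.
Proof.
move=> du dv dw neq uw vw.
have le_lcm_w : (mlcm u v <= w)%MM by rewrite lem_mlcm uw vw.
apply: (lem_mdeg_eq le_lcm_w); rewrite dw ltnNge; apply: contraNN neq => le_q.
apply/eqP; transitivity (mlcm u v).
- by apply: (lem_mdeg_eq (lem_mlcml _ _)); rewrite du.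
- by apply/esym/(lem_mdeg_eq (lem_mlcmr _ _)); rewrite dv.
Qed.

(** * Monomial ideals, described by the monomials they contain *)

Definition divisible_by (n : nat) (U : seq 'X_{1..n}) (m : 'X_{1..n}) : bool :=
  has (fun u => (u <= m)%MM) U.

Lemma divisible_by_trans (n : nat) (U : seq 'X_{1..n}) (m m' : 'X_{1..n}) :
  (m <= m')%MM -> divisible_by U m -> divisible_by U m'.
Proof.
move=> mm' /hasP[u uU um]; apply/hasP; exists u => //.
exact: lepm_trans um mm'.
Qed.

Lemma divisible_by_cat (n : nat) (U V : seq 'X_{1..n}) (m : 'X_{1..n}) :
  divisible_by (U ++ V) m = divisible_by U m || divisible_by V m.
Proof. exact: has_cat. Qed.

Lemma ideal_gen0 (R : comNzRingType) (s : seq R) : ideal_gen s 0.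
Proof. by exists (fun=> 0); rewrite big1 // => i _; rewrite mul0r. Qed.

Lemma ideal_genD (R : comNzRingType) (s : seq R) (p q : R) :
  ideal_gen s p -> ideal_gen s q -> ideal_gen s (p + q).
Proof.
case=> c -> [d ->]; exists (fun i => c i + d i).
by rewrite -big_split; apply: eq_bigr => i _; rewrite mulrDl.
Qed.

Lemma ideal_genM (R : comNzRingType) (s : seq R) (a p : R) :
  p \in s -> ideal_gen s (a * p).
Proof.
move=> ps; have lt_p : (index p s < size s)%N by rewrite index_mem.
(* [index] selects the first occurrence of [p], so a repeated generator is counted once. *)
exists (fun i => if i == index p s then a else 0).
rewrite (bigD1 (Ordinal lt_p)) //= eqxx nth_index // big1 ?addr0 // => i.
by rewrite -val_eqE /= => /negPf ->; rewrite mul0r.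
Qed.

(** Each term of a combination of generators is a multiple of some generator, and conversely [p] is
    the sum of its terms. This turns every question about these ideals into one about
    divisibility. *)
Lemma monomial_idealP (k : fieldType) (n : nat) (U : seq 'X_{1..n})
    (p : {mpoly k[n]}) :
  monomial_ideal k U p <-> {in msupp p, forall m, divisible_by U m}.
Proof.
split=> [[c ->] m | suppU].
- move/msupp_sum_le/flatten_mapP => [i _].
  have lt_iU : (i < size U)%N by rewrite -(size_map (mpolyX k)) ltn_ord.
  rewrite (nth_map 0%MM) // (perm_mem (msuppMX _ _)) => /mapP[m' _ ->].
  by apply/hasP; exists (nth 0%MM U i); [exact: mem_nth | exact: lem_addr].
- rewrite /monomial_ideal [p]mpolyE big_seq.
  apply: (big_ind (ideal_gen _)); first exact: ideal_gen0.
    exact: ideal_genD.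
  move=> m /suppU /hasP[u uU um].
  rewrite -(submK um) mpolyXD scalerAl.
  exact: ideal_genM (map_f _ uU).
Qed.

Lemma monomial_idealX (k : fieldType) (n : nat) (U : seq 'X_{1..n})
    (m : 'X_{1..n}) :
  monomial_ideal k U 'X_[m] <-> divisible_by U m.
Proof.
rewrite monomial_idealP; split=> [|Um m'].
- by apply; rewrite msuppX mem_head.
- by rewrite msuppX inE => /eqP ->.
Qed.

Lemma monomial_idealS (k : fieldType) (n : nat) (U V : seq 'X_{1..n}) :
  monomial_ideal k U `<=` monomial_ideal k V <->
  {in U, forall u, divisible_by V u}.
Proof.
split=> [UV u uU | UV p /monomial_idealP suppU].
- apply/(monomial_idealX k)/UV/monomial_idealX/hasP.
  by exists u => //; apply: lepm_refl.
- apply/monomial_idealP => m /suppU /hasP[u /UV Vu um].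
  exact: divisible_by_trans um Vu.
Qed.

Lemma monomial_ideal_add (k : fieldType) (n : nat) (U V : seq 'X_{1..n}) :
  ideal_add (monomial_ideal k U) (monomial_ideal k V) =
  monomial_ideal k (U ++ V).
Proof.
rewrite eqEsubset; split=> [_ [p pU [q qV <-]] | p /monomial_idealP suppUV].
- apply/monomial_idealP => m /msuppD_le; rewrite mem_cat divisible_by_cat.
  by case/orP => [/(proj1 (monomial_idealP _ _) pU)|
                  /(proj1 (monomial_idealP _ _) qV)] ->; rewrite ?orbT.
(* Split [p] into the terms divisible by a generator in [U] and the remaining ones, which must be
   divisible by one in [V]. *)
- exists (\sum_(m <- msupp p | divisible_by U m) p@_m *: 'X_[m]).
    apply/monomial_idealP => m /msupp_sum_le /flatten_mapP[m'].
    rewrite mem_filter => /andP[Um' _] /msuppZ_le.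
    by rewrite msuppX inE => /eqP ->.
  exists (\sum_(m <- msupp p | ~~ divisible_by U m) p@_m *: 'X_[m]).
    apply/monomial_idealP => m /msupp_sum_le /flatten_mapP[m'].
    rewrite mem_filter => /andP[nUm' /suppUV UVm'] /msuppZ_le.
    rewrite msuppX inE => /eqP ->; move: UVm'.
    by rewrite divisible_by_cat (negPf nUm').
  by rewrite [RHS]mpolyE [RHS](bigID (divisible_by U)).
Qed.

Definition pairwise_lcm (n : nat) (U V : seq 'X_{1..n}) : seq 'X_{1..n} :=
  [seq mlcm u v | u <- U, v <- V].

Lemma divisible_by_pairwise_lcm (n : nat) (U V : seq 'X_{1..n})
    (m : 'X_{1..n}) :
  divisible_by (pairwise_lcm U V) m =
  divisible_by U m && divisible_by V m.
Proof.
apply/hasP/andP => [[_ /allpairsP[[u v] /= [uU vV ->]]]|].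
- by rewrite lem_mlcm => /andP[um vm]; split; apply/hasP; [exists u | exists v].
- case=> /hasP[u uU um] /hasP[v vV vm].
  by exists (mlcm u v); [exact: allpairs_f | rewrite lem_mlcm um vm].
Qed.

Lemma monomial_idealI (k : fieldType) (n : nat) (U V : seq 'X_{1..n}) :
  monomial_ideal k U `&` monomial_ideal k V =
  monomial_ideal k (pairwise_lcm U V).
Proof.
rewrite eqEsubset; split=> [p [/monomial_idealP pU /monomial_idealP pV] | p].
- apply/monomial_idealP => m mp.
  by rewrite divisible_by_pairwise_lcm pU ?pV.
- move/monomial_idealP => pUV; split; apply/monomial_idealP => m /pUV;
  by rewrite divisible_by_pairwise_lcm => /andP[].
Qed.

(** * Polarization of monomials *)

Lemma polarize_monomialE (n d : nat) (u : 'X_{1..n}) (i : 'I_n) (j : 'I_d) :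
  polarize_monomial d u (mxvec_index i j) = (j < u i)%N.
Proof.
(* The numbering of the variables is injective, so each occurs at most once in the product. *)
have mxvec_index_eq i' j' :
    (mxvec_index i' j' == mxvec_index i j) = (i' == i) && (j' == j).
  apply/eqP/andP => [eq_ij|[/eqP -> /eqP ->] //].
  by have [-> ->] := enum_rank_inj (cast_ord_inj eq_ij).
rewrite /polarize_monomial mnm_sumE (bigD1 i) //= [X in (_ + X)%N]big1 => [|i'].
  rewrite addn0 mnm_sumE big_mkcond (bigD1 j) //= big1 => [|j' /negPf neq_j'].
    by rewrite addn0 mnm1E mxvec_index_eq !eqxx; case: (_ < _)%N.
  by rewrite mnm1E mxvec_index_eq neq_j' andbF; case: (_ < _)%N.
move=> /negPf neq_i'; rewrite mnm_sumE big1 // => j' _.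
by rewrite mnm1E mxvec_index_eq neq_i'.
Qed.

Lemma polarize_monomial_le (n d : nat) (u v : 'X_{1..n}) :
  (u <= v)%MM -> (polarize_monomial d u <= polarize_monomial d v)%MM.
Proof.
move/mnm_lepP => uv; apply/mnm_lepP; case/mxvec_indexP=> i j.
rewrite !polarize_monomialE; case: ltnP => // /leq_trans/(_ (uv i)) ->.
by [].
Qed.

(** In each variable, [j] is below the maximum of two exponents exactly when it is below one of
    them. *)
Lemma polarize_monomial_lcm (n d : nat) (u v : 'X_{1..n}) :
  polarize_monomial d (mlcm u v) =
  mlcm (polarize_monomial d u) (polarize_monomial d v).
Proof.
apply/mnmP; case/mxvec_indexP=> i j.
rewrite mnmE !polarize_monomialE mnmE leq_max.
by do 2 case: (_ < _)%N.
Qed.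

Lemma squarefree_polarize_monomial (n d : nat) (u : 'X_{1..n}) :
  squarefree_monomial (polarize_monomial d u).
Proof. by case/mxvec_indexP=> i j; rewrite polarize_monomialE leq_b1. Qed.

(** The bound rules out truncation, so row [i] contributes exactly [u i] variables. *)
Lemma mdeg_polarize_monomial (n d : nat) (u : 'X_{1..n}) :
  (forall i, u i <= d)%N -> mdeg (polarize_monomial d u) = mdeg u.
Proof.
move=> ud; rewrite /polarize_monomial mdeg_sum mdegE; apply: eq_bigr => i _.
rewrite mdeg_sum (eq_bigr (fun=> 1%N)) => [|j _]; last exact: mdeg1.
by rewrite (big_ord_narrow (ud i)) sum1_card card_ord.
Qed.

(** * Polarization of generating families *)

Definition polarize_seq (n d : nat) (U : seq 'X_{1..n}) : seq 'X_{1..n * d} :=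
  [seq polarize_monomial d u | u <- U].

(** Polarization is well defined on ideals: an inclusion says that each generator has a divisor in
    the other family, and polarizing preserves this. *)
Lemma polarize_seq_eq (k : fieldType) (n d : nat) (U V : seq 'X_{1..n}) :
  monomial_ideal k U = monomial_ideal k V ->
  monomial_ideal k (polarize_seq d U) = monomial_ideal k (polarize_seq d V).
Proof.
have sub U' V' : monomial_ideal k U' `<=` monomial_ideal k V' ->
    monomial_ideal k (polarize_seq d U') `<=`
    monomial_ideal k (polarize_seq d V').
  move/monomial_idealS => UV; apply/monomial_idealS => _ /mapP[u uU ->].
  have /hasP[v vV vu] := UV u uU.
  apply/hasP; exists (polarize_monomial d v); first exact: map_f.
  exact: polarize_monomial_le.
by rewrite !eqEsubset => -[UV VU]; split; apply: sub.
Qed.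

Lemma polarize_seqI (k : fieldType) (n d : nat) (U V W : seq 'X_{1..n}) :
  monomial_ideal k U `&` monomial_ideal k V = monomial_ideal k W ->
  monomial_ideal k (polarize_seq d U) `&` monomial_ideal k (polarize_seq d V)
  = monomial_ideal k (polarize_seq d W).
Proof.
rewrite !monomial_idealI => /(polarize_seq_eq d) <-; congr monomial_ideal.
rewrite /polarize_seq /pairwise_lcm map_allpairs allpairs_mapl allpairs_mapr.
by apply: eq_allpairs => u v; rewrite polarize_monomial_lcm.
Qed.

Lemma polarize_seq_degree (k : fieldType) (n d q : nat) (U : seq 'X_{1..n}) :
  all (fun u => mdeg u == q) U ->
  {in U, forall u : 'X_{1..n}, forall i, (u i <= d)%N} ->
  generated_in_degree q (monomial_ideal k (polarize_seq d U)).
Proof.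
move=> /allP degU Ud; exists (polarize_seq d U) => //.
apply/allP => _ /mapP[u uU ->]; rewrite mdeg_polarize_monomial ?degU //.
exact: Ud.
Qed.

(** * Generators in a fixed degree, and the exponent bounds they inherit *)

(** Each [v] has a divisor [u] in [U], which in turn has a divisor in [V]; equal degrees collapse
    this chain. Hence a bound on the exponents in [U] passes to [V]. *)
Lemma single_degree_generators_sub (k : fieldType) (n q : nat)
    (U V : seq 'X_{1..n}) :
  all (fun v => mdeg v == q) V -> monomial_ideal k U = monomial_ideal k V ->
  {subset V <= U}.
Proof.
move=> /allP degV UV v vV.
have /monomial_idealS/(_ v vV)/hasP[u uU uv] :
  monomial_ideal k V `<=` monomial_ideal k U by rewrite UV.
have /monomial_idealS/(_ u uU)/hasP[v' v'V v'u] :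
  monomial_ideal k U `<=` monomial_ideal k V by rewrite UV.
have v'v : v' = v.
  apply: lem_mdeg_eq (lepm_trans v'u uv) _.
  by rewrite (eqP (degV _ vV)) (eqP (degV _ v'V)).
by rewrite (@lem_anti _ v u) // -v'v.
Qed.

Lemma cap_generator_pairwise_lcm (k : fieldType) (n q : nat)
    (U V W : seq 'X_{1..n}) (w : 'X_{1..n}) :
  all (fun u => mdeg u == q) U -> all (fun v => mdeg v == q) V ->
  all (fun w => mdeg w == q.+1) W ->
  monomial_ideal k U `&` monomial_ideal k V = monomial_ideal k W ->
  w \in W -> w \in pairwise_lcm U V.
Proof.
move=> /allP degU /allP degV /allP degW; rewrite monomial_idealI => UVW wW.
have /monomial_idealS/(_ w wW) :
  monomial_ideal k W `<=` monomial_ideal k (pairwise_lcm U V) by rewrite UVW.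
rewrite divisible_by_pairwise_lcm => /andP[/hasP[u uU uw] /hasP[v vV vw]].
(* If [u = v], this monomial of degree [q] would lie in the intersection, whose generators have
   degree [q.+1]. *)
have neq_uv : u != v.
  apply/eqP => eq_uv; have : divisible_by W u.
    apply/(monomial_idealX k); rewrite -UVW.
    apply/monomial_idealX; rewrite divisible_by_pairwise_lcm.
    by apply/andP; split; apply/hasP; exists u; rewrite ?lepm_refl // eq_uv.
  case/hasP => w' w'W /lem_mdeg.
  by rewrite (eqP (degW _ w'W)) (eqP (degU _ uU)) ltnn.
apply/allpairsP; exists (u, v); split=> //=; apply/esym.
apply: (eq_mlcm_mdegS (q := q)) => //; apply/eqP.
- exact: degU.
- exact: degV.
- exact: degW.
Qed.

(** * Induction along the construction of the ideal *)

(** The family [U] is arbitrary, so that the induction hypotheses apply to the single-degree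
    generators of both summands and of their intersection, with the same [d]. *)
Lemma constructible_polarize (k : fieldType) (n d : nat)
    (I : set {mpoly k[n]}) (U : seq 'X_{1..n}) :
  constructible I -> I = monomial_ideal k U ->
  {in U, forall u : 'X_{1..n}, forall i, (u i <= d)%N} ->
  constructible (monomial_ideal k (polarize_seq d U)).
Proof.
move=> cI; elim: cI U => {I} [u|q I1 I2 _ IH1 g1 _ IH2 g2 _ IH12 g12] U.
- move=> /(polarize_seq_eq (U := [:: u]) d) <- _.
  exact: constructible_principal.
- case: g1 g2 g12 => [U1 deg1 E1] [U2 deg2 E2] [W degW EW].
  rewrite E1 E2 monomial_ideal_add => EU Ud.
  have sub12 : {subset U1 ++ U2 <= U}.
    apply: (single_degree_generators_sub (q := q) _ (esym EU)).
    by rewrite all_cat deg1.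
  have U1d : {in U1, forall u : 'X_{1..n}, forall i, (u i <= d)%N}.
    by move=> u uU1; apply/Ud/sub12; rewrite mem_cat uU1.
  have U2d : {in U2, forall u : 'X_{1..n}, forall i, (u i <= d)%N}.
    by move=> u uU2; apply/Ud/sub12; rewrite mem_cat uU2 orbT.
  have E12 : monomial_ideal k U1 `&` monomial_ideal k U2 = monomial_ideal k W.
    by rewrite -E1 -E2.
  (* Generators of the intersection are lcms, whose exponents are maxima of exponents already
     bounded by [d]. *)
  have Wd : {in W, forall w : 'X_{1..n}, forall i, (w i <= d)%N}.
    move=> w /(cap_generator_pairwise_lcm deg1 deg2 degW E12).
    by case/allpairsP=> -[u v] /= [uU1 vU2 ->] i; rewrite mnmE geq_max U1d ?U2d.
  rewrite -(polarize_seq_eq d EU) /polarize_seq map_cat.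
  rewrite -monomial_ideal_add.
  apply: (constructible_add (q := q)).
  + exact: IH1.
  + exact: polarize_seq_degree.
  + exact: IH2.
  + exact: polarize_seq_degree.
  + by rewrite (polarize_seqI d E12); apply: IH12.
  + by rewrite (polarize_seqI d E12); apply: polarize_seq_degree.
Qed.

Theorem proposition3p3p1 (k : fieldType) (n d : nat)
    (I : set {mpoly k[n]}) (J : set {mpoly k[n * d]}) :
  constructible I -> is_polarization I J -> squarefree_constructible J.
Proof.
move=> cI [U [EI Ud ->]]; split.
- exact: constructible_polarize cI EI Ud.
- exists (polarize_seq d U) => // _ /mapP[u _ ->].
  exact: squarefree_polarize_monomial.
Qed.
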